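(* Let $\mathbb{K}$ be an algebraically closed field and let $X = \mathbb{G}(1,\mathbb{P}^n)\subset\mathbb{P}^{\binom{n+1}{2}-1}$, $n\ge 3$, be the Plücker embedding of the Grassmannian manifold of lines in $\mathbb{P}^n$ over $\mathbb{K}$. Then $$\text{rank-index}(X) = 6.$$ Furthermore, the homogeneous ideal $I(X)$ has no quadratic polynomials of rank $\leq 5$.
   Context: A quadratic polynomial here means a nonzero homogeneous form of degree $2$; its rank is the rank of its associated symmetric matrix. For a variety $X\subset\mathbb{P}^r$ whose homogeneous ideal $I(X)$ is generated by quadratic forms, $\text{rank-index}(X)$ is the smallest integer $k$ such that $I(X)$ can be generated by quadratic forms of rank at most $k$. *)

(* Defs.v *)
From mathcomp Require Import all_boot all_order all_algebra.
From mathcomp Require Import mpoly.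

Set Implicit Arguments.
Unset Strict Implicit.
Unset Printing Implicit Defensive.

Import GRing.Theory.

Local Open Scope ring_scope.

(* A subset of P^(r-1) is given by its set of homogeneous coordinate vectors,
   i.e. by a predicate on 'rV[K]_r. *)

Section Ideals.

Variables (K : fieldType) (r : nat).
Implicit Types (p q : {mpoly K[r]}) (G I : {mpoly K[r]} -> Prop).

Definition ideal_gen G p : Prop :=
  exists s : seq ({mpoly K[r]} * {mpoly K[r]}),
    (forall t, t \in s -> G t.2) /\ p = \sum_(t <- s) t.1 * t.2.

Definition hom_ideal (X : 'rV[K]_r -> Prop) : {mpoly K[r]} -> Prop :=
  ideal_gen (fun f => (exists d : nat, f \is d.-homog) /\
                      (forall x, X x -> f.@[x ord0] = 0)).

Definition quadratic_polynomial q : Prop := q != 0 /\ q \is 2.-homog.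

(* If 2 != 0 in K, this is the symmetric matrix A with
   q = \sum_(i, j) A i j 'X_i 'X_j (see sym_mxE and sym_mx_uniq below). Not every
   quadratic form has such an A in characteristic 2, where the matrix used is
   that of the polar form q(x + y) - q(x) - q(y), i.e. "twice A". *)
Definition sym_mx q : 'M[K]_r :=
  \matrix_(i, j) ((if 2%:R == 0 :> K then 1 else 2%:R^-1) *
                  (q@_(U_(i) + U_(j)) *+ (i == j).+1)).

Definition quad_rank q : nat := \rank (sym_mx q).

Definition quad_generated I (k : nat) : Prop :=
  exists G : {mpoly K[r]} -> Prop,
    (forall q, G q -> quadratic_polynomial q /\ (quad_rank q <= k)%N) /\
    (forall p, I p <-> ideal_gen G p).

Definition is_rank_index (X : 'rV[K]_r -> Prop) (k : nat) : Prop :=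
  quad_generated (hom_ideal X) k /\
  (forall k' : nat, quad_generated (hom_ideal X) k' -> (k <= k')%N).

Lemma mnmU2_eq (i j a b : 'I_r) :
  ((U_(i) + U_(j))%MM == (U_(a) + U_(b))%MM) =
  ((i == a) && (j == b)) || ((i == b) && (j == a)).
Proof.
have U_inj (x y : 'I_r) : U_(x)%MM = U_(y)%MM -> x = y.
  move/(congr1 (fun m : 'X_{1..r} => m x)); rewrite !mnm1E eqxx.
  by case: (altP (y =P x)).
apply/eqP/orP => [E|[] /andP[/eqP-> /eqP->] //]; last by rewrite addmC.
have := congr1 (fun m : 'X_{1..r} => m i) E; rewrite !mnmDE !mnm1E eqxx.
case: (altP (a =P i)) => [ai _|_].
  by left; move: E; rewrite ai => /addmI/U_inj->; rewrite !eqxx.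
case: (altP (b =P i)) => [bi _|//].
by right; move: E; rewrite bi [RHS]addmC => /addmI/U_inj->; rewrite !eqxx.
Qed.

Lemma mcoeffU2 (i j a b : 'I_r) :
  ('X_i * 'X_j : {mpoly K[r]})@_(U_(a) + U_(b)) =
  (((i == a) && (j == b)) || ((i == b) && (j == a)))%:R.
Proof. by rewrite -mpolyXD mcoeffX mnmU2_eq. Qed.

Lemma mcoeff_quad (A : 'M[K]_r) (a b : 'I_r) :
  (\sum_i \sum_j A i j *: ('X_i * 'X_j : {mpoly K[r]}))@_(U_(a) + U_(b)) =
  if a == b then A a b else A a b + A b a.
Proof.
pose F i j := A i j * (((i == a) && (j == b)) || ((i == b) && (j == a)))%:R.
transitivity (\sum_i \sum_j F i j).
  rewrite raddf_sum; apply: eq_bigr => i _; rewrite raddf_sum.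
  by apply: eq_bigr => j _; rewrite /= mcoeffZ mcoeffU2.
rewrite pair_bigA /= (bigD1 (a, b)) //= {1}/F !eqxx mulr1.
have F0 u : u != (a, b) -> u != (b, a) -> F u.1 u.2 = 0.
  case: u => i j; rewrite !xpair_eqE /F /=.
  by move=> /negPf-> /negPf->; rewrite mulr0.
case: (altP (a =P b)) => [ab|ab].
  by rewrite big1 ?addr0 // => u uab; apply: F0; rewrite // ab in uab *.
rewrite (bigD1 (b, a)) /=; last by rewrite xpair_eqE (eq_sym b) (negPf ab).
rewrite {1}/F !eqxx orbT mulr1 big1 ?addr0 // => u /andP[]; exact: F0.
Qed.

Let half_double (x : K) : 2%:R != 0 :> K -> 2%:R^-1 * (x *+ 2) = x.
Proof. by move=> two0; rewrite -(mulr_natl x) mulKf. Qed.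

Lemma sym_mxE q : 2%:R != 0 :> K -> q \is 2.-homog ->
  (sym_mx q)^T = sym_mx q /\
  q = \sum_i \sum_j sym_mx q i j *: ('X_i * 'X_j).
Proof.
move=> two0 hq; have symA : (sym_mx q)^T = sym_mx q.
  by apply/matrixP => i j; rewrite !mxE (eq_sym j) [(U_(j) + _)%MM]addmC.
split=> //; apply/mpolyP => m.
have [m2|m2] := eqVneq (mdeg m) 2; last first.
  rewrite (dhomog_nemf_coeff hq m2) raddf_sum big1 // => i _.
  rewrite raddf_sum big1 // => j _; rewrite /= mcoeffZ -mpolyXD mcoeffX.
  case: eqP => [E|_]; last by rewrite mulr0.
  by case/eqP: m2; rewrite -E mdegD !mdeg1.
have /existsP [a ma] : [exists a, m a != 0%N].
  apply: contra_eqT m2 => /existsPn m0; rewrite mdegE big1 // => i _.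
  by apply/eqP; move: (m0 i); rewrite negbK.
have le_a : (U_(a) <= m)%MM by rewrite lep1mP.
have /mdeg1P [b /eqP mb] : mdeg (m - U_(a))%MM == 1%N.
  by have := mdegD (m - U_(a))%MM U_(a); rewrite submK // m2 mdeg1 addn1 => -[<-].
rewrite -(submK le_a) mb mcoeff_quad !mxE (negPf two0) (eq_sym a b).
case: (altP (b =P a)) => [->|_].
  by rewrite half_double.
by rewrite [(U_(a) + U_(b))%MM]addmC -mulrDr -mulr2n half_double.
Qed.

Lemma sym_mx_uniq (A : 'M[K]_r) : 2%:R != 0 :> K -> A^T = A ->
  sym_mx (\sum_i \sum_j A i j *: ('X_i * 'X_j)) = A.
Proof.
move=> two0 sA; apply/matrixP => i j; rewrite mxE mcoeff_quad (negPf two0).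
have Aji : A j i = A i j by rewrite -[in RHS]sA mxE.
by case: eqP => _; rewrite ?Aji -?mulr2n half_double.
Qed.

End Ideals.

Section Grassmannian.

Variables (K : fieldType) (n : nat).

(* The Plücker coordinates on P^n are indexed by the pairs i < j <= n. *)
Definition plucker_pair := [pred p : 'I_n.+1 * 'I_n.+1 | (p.1 < p.2)%N].

Lemma card_plucker_pair : #|plucker_pair| = 'C(n.+1, 2).
Proof.
transitivity (\sum_(i < n.+1) \sum_(j < n.+1 | (i < j)%N) 1)%N.
  by rewrite (pair_big_dep predT) sum1_card; apply: eq_card => u; rewrite !inE.
rewrite (exchange_big_dep predT) //= -bin2_sum big_mkord.
apply: eq_bigr => j _.
by rewrite (big_ord_narrow (ltnW (ltn_ord j))) sum_nat_const card_ord muln1.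
Qed.

Definition nth_pair (k : 'I_('C(n.+1, 2))) : 'I_n.+1 * 'I_n.+1 :=
  enum_val (cast_ord (esym card_plucker_pair) k).

Definition plucker (A : 'M[K]_(2, n.+1)) : 'rV[K]_('C(n.+1, 2)) :=
  \row_k let: (i, j) := nth_pair k in
         \det (\matrix_(a < 2, b < 2) A a (if b == ord0 then i else j)).

(* A line in P^n is the row space of a 2 x (n+1) matrix A of rank 2. *)
Definition grassmannian_lines (x : 'rV[K]_('C(n.+1, 2))) : Prop :=
  exists (A : 'M[K]_(2, n.+1)) (c : K),
    [/\ \rank A = 2, c != 0 & x = c *: plucker A].

End Grassmannian.

(* Main.v *)
Require Import Defs.
From mathcomp Require Import all_boot all_order all_algebra.
From mathcomp Require Import mpoly.
From mathcomp Require Import zify ring.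

Set Implicit Arguments.
Unset Strict Implicit.
Unset Printing Implicit Defensive.

Import GRing.Theory.

Local Open Scope ring_scope.

(* Let S(u, v) be the polar form of a quadric containing X. Polarizing its
   vanishing at all a /\ b shows that S(a /\ b, c /\ d) is alternating in the four
   vectors; if it is nonzero at (a, b, c, d), the six pairs of these vectors give
   an invertible 6 x 6 block, so the rank is at least 6. This covers all
   characteristics.
   Conversely the three-term relations, of rank 6, generate I(X). They rewrite
   p_ad p_bc (a < b < c < d) as p_ac p_bd - p_ab p_cd, which lowers the total of
   (j - i)^2 over the factors p_ij, so every form is congruent to a combination of
   standard monomials, those without such a nested pair of factors. On the lines
   spanned by x_i = t^(B^(n+1+n-i)), y_j = t^(B^j), the standard monomials of a given
   degree d < B are monic polynomials in t of distinct degrees: the base-B digits of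
   the degree count the first and the second indices of the factors, which determine a
   standard monomial. So standard monomials are linearly independent on X. *)

(** * Monomials of degree two and evaluation of forms *)

Lemma mnm_deg2P (r : nat) (m : 'X_{1..r}) :
  mdeg m = 2 -> exists i j, m = (U_(i) + U_(j))%MM.
Proof.
move=> m2.
have /existsP [a ma] : [exists a, m a != 0%N].
  apply: contra_eqT m2 => /existsPn m0; rewrite mdegE big1 // => i _.
  by apply/eqP; move: (m0 i); rewrite negbK.
have le_a : (U_(a) <= m)%MM by rewrite lep1mP.
have /mdeg1P [b /eqP mb] : mdeg (m - U_(a))%MM == 1%N.
  by have := mdegD (m - U_(a))%MM U_(a); rewrite submK // m2 mdeg1 addn1 => -[<-].
by exists b, a; rewrite -(submK le_a) mb.
Qed.

Lemma meval_homogZ (K : fieldType) (r d : nat) (f : {mpoly K[r]}) c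
    (v : 'I_r -> K) :
  f \is d.-homog -> f.@[fun i => c * v i] = c ^+ d * f.@[v].
Proof.
move=> hf; rewrite !mevalE mulr_sumr; apply: eq_big_seq => m mf.
have <- : mdeg m = d by apply: (dhomog_mf hf mf).
rewrite mulrCA mdegE; congr (_ * _).
rewrite -prodrXr -big_split /=; apply: eq_bigr => i _.
by rewrite exprMn.
Qed.

Lemma meval_sum (K : fieldType) (r : nat) (I : Type) (s : seq I)
    (F : I -> {mpoly K[r]}) v :
  (\sum_(i <- s) F i).@[v] = \sum_(i <- s) (F i).@[v].
Proof. exact: raddf_sum. Qed.

(** * Closure properties of generated ideals *)

Section IdealGen.

Variables (K : fieldType) (r : nat) (G : {mpoly K[r]} -> Prop).
Implicit Types p q f : {mpoly K[r]}.

Lemma ideal_gen_base p : G p -> ideal_gen G p.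
Proof.
move=> Gp; exists [:: (1, p)]; rewrite big_seq1 mul1r; split=> // t.
by rewrite inE => /eqP->.
Qed.

Lemma ideal_gen0 : ideal_gen G 0.
Proof. by exists [::]; rewrite big_nil. Qed.

Lemma ideal_genD p q : ideal_gen G p -> ideal_gen G q -> ideal_gen G (p + q).
Proof.
move=> [s [sG ->]] [t [tG ->]]; exists (s ++ t); rewrite big_cat; split=> // u.
by rewrite mem_cat => /orP[/sG|/tG].
Qed.

Lemma ideal_genM p q : ideal_gen G q -> ideal_gen G (p * q).
Proof.
move=> [s [sG ->]]; exists [seq (p * t.1, t.2) | t <- s]; split.
  by move=> _ /mapP[t /sG Gt ->].
by rewrite big_map mulr_sumr; apply: eq_bigr => t _; rewrite mulrA.
Qed.

Lemma ideal_gen_sum (T : eqType) (s : seq T) (F : T -> {mpoly K[r]}) :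
  (forall t, t \in s -> ideal_gen G (F t)) -> ideal_gen G (\sum_(t <- s) F t).
Proof.
move=> sG; rewrite big_seq; elim/big_ind: _ => //; first exact: ideal_gen0.
exact: ideal_genD.
Qed.

Lemma ideal_gen_eval0 (v : 'I_r -> K) p :
  (forall q, G q -> q.@[v] = 0) -> ideal_gen G p -> p.@[v] = 0.
Proof.
move=> G0 [s [sG ->]]; rewrite meval_sum big1_seq // => t /andP[_ /sG Gt].
by rewrite mevalM (G0 _ Gt) mulr0.
Qed.

End IdealGen.

(** * Plücker coordinates and vanishing on the Grassmannian *)

Section Plucker.

Variables (K : fieldType) (n : nat).
Local Notation r := 'C(n.+1, 2).
Local Notation X := (@grassmannian_lines K n).
Implicit Types (i j k l : 'I_n.+1).

Lemma det_mx22 (M : 'M[K]_2) :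
  \det M = M ord0 ord0 * M ord_max ord_max - M ord_max ord0 * M ord0 ord_max.
Proof.
rewrite (expand_det_col _ ord0) !big_ord_recl big_ord0 addr0.
rewrite /cofactor !det_mx11 !mxE /= !add0n expr0 expr1 mul1r mulN1r mulrN.
have -> : lift ord0 ord0 = ord_max :> 'I_2 by apply: val_inj.
by have -> : lift ord_max 0 = ord0 :> 'I_2 by apply: val_inj.
Qed.

Lemma pluckerE (A : 'M[K]_(2, n.+1)) (u : 'I_r) :
  plucker A ord0 u =
  A ord0 (nth_pair u).1 * A ord_max (nth_pair u).2 -
  A ord_max (nth_pair u).1 * A ord0 (nth_pair u).2.
Proof. by rewrite mxE; case: (nth_pair u) => i j; rewrite det_mx22 !mxE. Qed.

Lemma nth_pair_lt (u : 'I_r) : ((nth_pair u).1 < (nth_pair u).2)%N.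
Proof. exact: (enum_valP (cast_ord (esym (card_plucker_pair n)) u)). Qed.

Lemma nth_pair_inj : injective (@nth_pair n).
Proof. by move=> u v /enum_val_inj /cast_ord_inj. Qed.

Lemma nth_pair_surj i j : (i < j)%N -> exists u, nth_pair u = (i, j).
Proof.
move=> ij; pose x := (i, j).
have Px : x \in plucker_pair n by [].
exists (cast_ord (card_plucker_pair n) (enum_rank_in Px x)).
by rewrite /nth_pair cast_ordK enum_rankK_in.
Qed.

(** A 2 x 2 submatrix of columns factors through [A], so a nonzero minor forces rank 2. Vanishing on
    X can thus be tested on all 2 x (n+1) matrices, with no rank condition. *)
Lemma plucker_degenerate (A : 'M[K]_(2, n.+1)) : \rank A != 2 -> plucker A = 0.
Proof.
move=> rA; apply/rowP => u; rewrite mxE [RHS]mxE.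
case: (nth_pair u) => i j; apply/eqP; apply: contraR rA.
set M := \matrix_(_, _) _ => detM.
have : (\rank M <= \rank A)%N.
  have -> : M = A *m \matrix_(k, b) (k == if b == ord0 then i else j)%:R.
    apply/matrixP => a b; rewrite !mxE (bigD1 (if b == ord0 then i else j)) //=.
    rewrite mxE eqxx mulr1 big1 ?addr0 // => k kb.
    by rewrite mxE (negPf kb) mulr0.
  exact: mxrankM_maxl.
rewrite mxrank_unit ?unitmxE ?unitfE // => rA.
by rewrite eqn_leq rank_leq_row rA.
Qed.

Hypothesis n_gt0 : (0 < n)%N.

Lemma grassmannian_lines_nonempty : exists x, X x.
Proof.
exists (1 *: plucker (pid_mx 2)), (pid_mx 2), 1.
by rewrite rank_pid_mx // oner_eq0.
Qed.

(** A degenerate [A] has the zero Plücker vector, which is 0 times a point x of X; there f takes the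
    value 0^d f(x) = 0. Going through x also covers d = 0. *)
Lemma homog_eval_plucker d f (A : 'M[K]_(2, n.+1)) :
  f \is d.-homog -> (forall x, X x -> f.@[x ord0] = 0) ->
  f.@[plucker A ord0] = 0.
Proof.
move=> hf f0; have [rA|/plucker_degenerate->] := eqVneq (\rank A) 2.
  by apply: f0; exists A, 1; rewrite scale1r oner_eq0.
have [x Xx] := grassmannian_lines_nonempty.
have /= := meval_homogZ 0 (x ord0) hf; rewrite (f0 _ Xx) mulr0 => <-.
by apply: meval_eq => u; rewrite mxE mul0r.
Qed.

Lemma hom_ideal_eval_plucker f (A : 'M[K]_(2, n.+1)) :
  hom_ideal X f -> f.@[plucker A ord0] = 0.
Proof. by apply: ideal_gen_eval0 => q [[d hq]]; apply: homog_eval_plucker hq. Qed.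

Lemma hom_ideal_of_plucker d f :
  f \is d.-homog -> (forall A : 'M[K]_(2, n.+1), f.@[plucker A ord0] = 0) ->
  hom_ideal X f.
Proof.
move=> hf f0; apply: ideal_gen_base; split; first by exists d.
move=> x [A [c [_ _ ->]]].
rewrite (meval_eq (v2 := fun u => c * plucker A ord0 u)); last first.
  by move=> u; rewrite mxE.
by rewrite (meval_homogZ _ _ hf) f0 mulr0.
Qed.

End Plucker.

(** * Quadratic forms, polar forms and rank in every characteristic *)

Section QuadraticForms.

Variables (K : fieldType) (r : nat).
Implicit Types (q : {mpoly K[r]}) (A : 'M[K]_r) (x y : 'rV[K]_r).

(** [A] need not be symmetric, so that every quadratic form arises this way, in characteristic 2 as
    well. *)
Definition quad_of A : {mpoly K[r]} := \sum_i \sum_j A i j *: ('X_i * 'X_j).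

Definition bilin A x y : K := (x *m A *m y^T) ord0 ord0.

(** The Gram matrix of the polar form q(x + y) - q(x) - q(y) of q = [quad_of A]; it depends only on
    q and not on the choice of [A]. *)
Definition polar_mx A : 'M[K]_r := A + A^T.

Lemma quad_ofD A B : quad_of (A + B) = quad_of A + quad_of B.
Proof.
rewrite /quad_of -big_split; apply: eq_bigr => i _; rewrite -big_split.
by apply: eq_bigr => j _; rewrite mxE scalerDl.
Qed.

Lemma quad_ofZ c A : quad_of (c *: A) = c *: quad_of A.
Proof.
rewrite /quad_of scaler_sumr; apply: eq_bigr => i _; rewrite scaler_sumr.
by apply: eq_bigr => j _; rewrite mxE scalerA.
Qed.

Lemma quad_of_delta i j : quad_of (delta_mx i j) = 'X_i * 'X_j.
Proof.
rewrite /quad_of (bigD1 i) //= (bigD1 j) //= mxE !eqxx scale1r.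
rewrite !big1 ?addr0 // => k kn; rewrite ?mxE ?(negPf kn) ?andbF ?scale0r //.
by rewrite big1 // => l _; rewrite mxE (negPf kn) scale0r.
Qed.

Lemma homog2_quad_of q : q \is 2.-homog -> exists A, q = quad_of A.
Proof.
move=> hq; rewrite (mpolyE q) big_seq.
elim/big_ind: _ => [|_ _ [A ->] [B ->]|m mq].
- by exists 0; rewrite /quad_of big1 // => i _; rewrite big1 // => j _;
    rewrite mxE scale0r.
- by exists (A + B); rewrite quad_ofD.
have [i [j ->]] := mnm_deg2P (dhomog_mf hq mq).
by exists (q@_(U_(i) + U_(j)) *: delta_mx i j);
  rewrite quad_ofZ quad_of_delta mpolyXD.
Qed.

Lemma quad_of_eval A x : (quad_of A).@[x ord0] = bilin A x x.
Proof.
rewrite /bilin -mulmxA mxE meval_sum; apply: eq_bigr => i _.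
rewrite meval_sum mxE mulr_sumr; apply: eq_bigr => j _.
by rewrite mevalZ mevalM !mevalXU !mxE; ring.
Qed.

Lemma bilinDl A x y z : bilin A (x + y) z = bilin A x z + bilin A y z.
Proof. by rewrite /bilin !mulmxDl mxE. Qed.

Lemma bilinDr A x y z : bilin A x (y + z) = bilin A x y + bilin A x z.
Proof. by rewrite /bilin linearD mulmxDr mxE. Qed.

Lemma bilinC A x y : bilin (A^T) x y = bilin A y x.
Proof.
rewrite /bilin; transitivity ((y *m A *m x^T)^T ord0 ord0); last by rewrite mxE.
by rewrite !trmx_mul trmxK mulmxA.
Qed.

Lemma bilin_polar A x y : bilin (polar_mx A) x y = bilin A x y + bilin A y x.
Proof. by rewrite -[bilin A y x]bilinC /bilin mulmxDr mulmxDl mxE. Qed.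

Lemma bilin_delta A i j :
  bilin A (delta_mx ord0 i) (delta_mx ord0 j) = A i j.
Proof. by rewrite /bilin -rowE trmx_delta -colE !mxE. Qed.

(* The factor is 1/2, or 1 in characteristic 2. *)
Lemma sym_mx_quad_of A : exists2 c : K, c != 0 &
  sym_mx (quad_of A) = c *: polar_mx A.
Proof.
exists (if 2%:R == 0 :> K then 1 else 2%:R^-1).
  by case: ifP => [_|/negbT]; rewrite ?oner_eq0 // invr_eq0.
apply/matrixP => i j; rewrite !mxE mcoeff_quad; congr (_ * _).
by case: eqP => [->|_]; rewrite ?mulr2n.
Qed.

Lemma quad_rank_quad_of A : quad_rank (quad_of A) = \rank (polar_mx A).
Proof.
by rewrite /quad_rank; have [c c0 ->] := sym_mx_quad_of A; apply: mxrank_scale_nz.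
Qed.

Lemma rank_polar_delta i j : (\rank (polar_mx (delta_mx i j)) <= 2)%N.
Proof.
by apply: leq_trans (mxrank_add _ _) _; rewrite trmx_delta !mxrank_delta.
Qed.

End QuadraticForms.

(** * The lower bound: the polar form on decomposable bivectors *)

Section Wedge.

Variables (K : fieldType) (n : nat).
Local Notation r := 'C(n.+1, 2).
Local Notation X := (@grassmannian_lines K n).
Implicit Types (a b c d : 'rV[K]_n.+1).

Definition wedge a b : 'rV[K]_r := plucker (\matrix_(k < 2) if k == ord0 then a else b).

Lemma wedgeE a b u :
  wedge a b ord0 u =
  a ord0 (nth_pair u).1 * b ord0 (nth_pair u).2 -
  b ord0 (nth_pair u).1 * a ord0 (nth_pair u).2.
Proof. by rewrite pluckerE !mxE. Qed.

(* [rowP] with the index [ord0] in place of the ring element [0 : 'I_1]. *)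
Let row_eq (x y : 'rV[K]_r) : (forall u, x ord0 u = y ord0 u) -> x = y.
Proof. by move=> xy; apply/rowP => u; apply: xy. Qed.

Lemma wedgeDl a b c : wedge (a + b) c = wedge a c + wedge b c.
Proof. by apply: row_eq => u; rewrite [RHS]mxE !wedgeE !mxE; ring. Qed.

Lemma wedgeDr a b c : wedge a (b + c) = wedge a b + wedge a c.
Proof. by apply: row_eq => u; rewrite [RHS]mxE !wedgeE !mxE; ring. Qed.

Lemma wedgeC a b : wedge b a = - wedge a b.
Proof. by apply: row_eq => u; rewrite [RHS]mxE !wedgeE; ring. Qed.

(** The coordinate vectors are decomposable, so each entry of a polar matrix is a value of the polar
    form on two decomposable bivectors. *)
Lemma wedge_delta u :
  wedge (delta_mx ord0 (nth_pair u).1) (delta_mx ord0 (nth_pair u).2) =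
  delta_mx ord0 u.
Proof.
have lt_u := nth_pair_lt u.
apply: row_eq => v; rewrite wedgeE !mxE !eqxx /=.
have -> : (v == u) = (nth_pair v == nth_pair u) by rewrite (inj_eq (@nth_pair_inj n)).
have := nth_pair_lt v; move: lt_u; case: (nth_pair u) => i j; case: (nth_pair v) => k l /=.
rewrite xpair_eqE -!natrM !mulnb; move=> ij kl.
have -> : (k == j) && (l == i) = false.
  by apply/negP => /andP[/eqP kj /eqP li]; move: kl; rewrite kj li ltnNge ltnW.
by rewrite subr0.
Qed.

Variable A : 'M[K]_r.
Hypothesis vanish : forall a b, bilin A (wedge a b) (wedge a b) = 0.

Let T a b c d := bilin (polar_mx A) (wedge a b) (wedge c d).

(** Expand the vanishing at a /\ (b + c), which is again decomposable. *)
Lemma polar_wedge_l a b c : T a b a c = 0.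
Proof.
rewrite /T bilin_polar; have := vanish a (b + c).
by rewrite wedgeDr bilinDl !bilinDr !vanish add0r addr0.
Qed.

Let bilinNl (B : 'M[K]_r) x y : bilin B (- x) y = - bilin B x y.
Proof. by rewrite /bilin !mulNmx mxE. Qed.

Let bilinNr (B : 'M[K]_r) x y : bilin B x (- y) = - bilin B x y.
Proof. by rewrite /bilin linearN mulmxN mxE. Qed.

Lemma polar_wedgeC12 a b c d : T b a c d = - T a b c d.
Proof. by rewrite /T wedgeC bilinNl. Qed.

Lemma polar_wedgeC34 a b c d : T a b d c = - T a b c d.
Proof. by rewrite /T [wedge d c]wedgeC bilinNr. Qed.

Lemma polar_wedgeS a b c d : T c d a b = T a b c d.
Proof. by rewrite /T !bilin_polar addrC. Qed.

Lemma polar_wedge0 a b c d : [|| a == c, a == d, b == c | b == d] -> T a b c d = 0.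
Proof.
case/or4P => /eqP->.
- exact: polar_wedge_l.
- by rewrite polar_wedgeC34 polar_wedge_l oppr0.
- by rewrite polar_wedgeC12 polar_wedge_l oppr0.
by rewrite polar_wedgeC12 polar_wedgeC34 polar_wedge_l !oppr0.
Qed.

(** Polarization of the preceding vanishing: put a + c in both the first and the third place. *)
Lemma polar_wedgeC13 a b c d : T c b a d = - T a b c d.
Proof.
have := polar_wedge_l (a + c) b d; rewrite /T !wedgeDl bilinDl !bilinDr -!/(T _ _ _ _).
by rewrite !polar_wedge_l add0r addr0 => /eqP; rewrite addrC addr_eq0 => /eqP.
Qed.

Lemma polar_wedge_rank a b c d : T a b c d != 0 -> (6 <= \rank (polar_mx A))%N.
Proof.
move=> T0.
pose z := (a, b).
(* The order is chosen so that reversing the list sends each pair to the complementary pair. *)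
pose s := [:: (a, b); (a, c); (a, d); (b, c); (b, d); (c, d)].
pose W : 'M_(6, r) := \matrix_k wedge (nth z s k).1 (nth z s k).2.
pose W' : 'M_(6, r) := \matrix_k wedge (nth z (rev s) k).1 (nth z (rev s) k).2.
pose M := W *m polar_mx A *m W'^T.
have ME i j : M i j = T (nth z s i).1 (nth z s i).2
                        (nth z (rev s) j).1 (nth z (rev s) j).2.
  rewrite /T /bilin /M mxE [RHS]mxE; apply: eq_bigr => k _.
  rewrite !mxE; congr (_ * _); apply: eq_bigr => l _.
  by rewrite /W mxE.
have Tacbd : T a c b d = - T a b c d.
  by rewrite polar_wedgeC12 polar_wedgeC13 polar_wedgeC12 !opprK.
have Tadbc : T a d b c = T a b c d.
  by rewrite polar_wedgeC34 polar_wedgeC12 polar_wedgeC13 polar_wedgeC34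
     polar_wedgeC13 polar_wedgeC12 !opprK.
(* Two pairs that are not complementary share a vector, so [M] is diagonal; its diagonal entries are
   the value at (a, b, c, d) up to sign. *)
have M0 i j : i != j -> M i j = 0.
  move=> ij; rewrite ME; apply: polar_wedge0; move: ij.
  by case: i => [[|[|[|[|[|[|//]]]]]] ?]; case: j => [[|[|[|[|[|[|//]]]]]] ?] //=;
    rewrite !eqxx ?orbT.
have Mdiag i : M i i != 0.
  rewrite ME; case: i => [[|[|[|[|[|[|//]]]]]] ?] /=;
  rewrite ?[T b _ _ _]polar_wedgeS ?[T c _ _ _]polar_wedgeS ?Tacbd ?Tadbc ?oppr_eq0 //.
have Munit : M \in unitmx.
  have -> : M = diag_mx (\row_i M i i).
    apply/matrixP => i j; rewrite [RHS]mxE; case: (eqVneq i j) => [->|ij].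
      by rewrite mulr1n [RHS]mxE.
    by rewrite mulr0n; apply: M0.
  rewrite unitmxE det_diag unitfE; apply/prodf_neq0 => i _.
  by rewrite [X in X != 0]mxE.
rewrite -(mxrank_unit Munit).
exact: leq_trans (mxrankM_maxl _ _) (mxrankM_maxr _ _).
Qed.

End Wedge.

Lemma hom_ideal_rank_ge6 (K : fieldType) (n : nat) (q : {mpoly K['C(n.+1, 2)]}) :
  (0 < n)%N -> hom_ideal (@grassmannian_lines K n) q -> quadratic_polynomial q ->
  (6 <= quad_rank q)%N.
Proof.
move=> n0 Iq [q0 hq]; have [A qA] := homog2_quad_of hq.
have vanish a b : bilin A (wedge a b) (wedge a b) = 0.
  by rewrite -quad_of_eval -qA; apply: hom_ideal_eval_plucker.
rewrite qA quad_rank_quad_of.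
(* The diagonal of [A] vanishes because coordinate vectors are decomposable. Hence a monomial of q
   is a product of two distinct variables, and its coefficient is an entry of the polar matrix. *)
have [u [v]] : exists u v, polar_mx A u v != 0.
  have Adiag u : A u u = 0 by rewrite -bilin_delta -wedge_delta vanish.
  have [m mq] : exists m, m \in msupp q.
    by exists (mlead q); rewrite mlead_supp.
  have [u [v muv]] := mnm_deg2P (dhomog_mf hq mq).
  exists u, v; move: mq; rewrite mcoeff_msupp muv qA mcoeff_quad /polar_mx !mxE.
  by have [<-|] := eqVneq u v; rewrite ?Adiag ?eqxx.
rewrite -bilin_delta -2!wedge_delta; exact: (polar_wedge_rank vanish).
Qed.

(** * Straightening modulo quadrics of rank at most 6 *)

Section Straightening.

Variables (K : fieldType) (n : nat).
Hypothesis n_gt0 : (0 < n)%N.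
Local Notation r := 'C(n.+1, 2).
Local Notation X := (@grassmannian_lines K n).
Implicit Types (u v : 'I_r) (m : 'X_{1..r}) (f p : {mpoly K[r]}).

Definition low_rank_quadric (q : {mpoly K[r]}) : Prop :=
  [/\ quadratic_polynomial q, (quad_rank q <= 6)%N & hom_ideal X q].

Local Notation J := (ideal_gen low_rank_quadric).

Definition nested u v : bool :=
  ((nth_pair u).1 < (nth_pair v).1)%N && ((nth_pair v).2 < (nth_pair u).2)%N.

(** With the index pairs as columns, these are the monomials of semistandard tableaux with two
    rows. *)
Definition standard m : bool :=
  [forall u, forall v, (0 < m u)%N && (0 < m v)%N ==> ~~ nested u v].

(** The square matters: for a < b < c < d the plain lengths satisfy (d - a) + (c - b) = (c - a) + (d
    - b), and only the sum of squares drops strictly. *)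
Definition spread u : nat := ((nth_pair u).2 - (nth_pair u).1) ^ 2.

Definition total_spread m : nat := \sum_u m u * spread u.

Lemma three_term_low_rank u v u1 v1 u2 v2 :
  u \notin [:: u1; v1; u2; v2] ->
  (forall A : 'M[K]_(2, n.+1),
     let x := plucker A ord0 in x u * x v - x u1 * x v1 + x u2 * x v2 = 0) ->
  low_rank_quadric ('X_u * 'X_v - 'X_u1 * 'X_v1 + 'X_u2 * 'X_v2).
Proof.
move=> uN vanish; set q := (_ + _).
have hX w w' : ('X_w * 'X_w' : {mpoly K[r]}) \is 2.-homog.
  by apply: (@dhomogM _ _ _ 1 _ 1); rewrite dhomogX /= mdeg1.
have hq : q \is 2.-homog by rewrite rpredD ?rpredB.
split.
(* By [uN] the other two products miss the monomial ['X_u * 'X_v], whose coefficient is therefore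
   1. *)
- split=> //; apply/eqP => /(congr1 (mcoeff (U_(u) + U_(v))%MM)) /eqP.
  rewrite mcoeff0 mcoeffD mcoeffB !mcoeffU2 !eqxx /=; move: uN.
  rewrite !inE !negb_or => /and4P[]; do 4! rewrite eq_sym => /negPf->.
  by rewrite /= !andbF subr0 addr0 oner_eq0.
- have -> : q = quad_of (delta_mx u v - delta_mx u1 v1 + delta_mx u2 v2).
    by rewrite !quad_ofD -[- delta_mx _ _]scaleN1r quad_ofZ !quad_of_delta scaleN1r.
  rewrite quad_rank_quad_of.
  set D1 := delta_mx u v; set D2 := delta_mx u1 v1; set D3 := delta_mx u2 v2.
  have -> : polar_mx (D1 - D2 + D3) = polar_mx D1 - polar_mx D2 + polar_mx D3.
    by apply/matrixP => i j; rewrite !mxE; ring.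
  apply: leq_trans (mxrank_add _ _) _.
  apply: (@leq_add _ _ 4 2); last exact: rank_polar_delta.
  apply: leq_trans (mxrank_add _ _) _; rewrite mxrank_opp.
  by apply: (@leq_add _ _ 2 2); apply: rank_polar_delta.
apply: hom_ideal_of_plucker hq _ => // A.
by rewrite mevalD mevalB !mevalM !mevalXU vanish.
Qed.

(** For u = (a, d) and v = (b, c) this is the Plücker relation p_ad p_bc - p_ac p_bd + p_ab p_cd =
    0. *)
Lemma nested_relation u v : nested u v ->
  exists u1 v1 u2 v2,
  [/\ low_rank_quadric ('X_u * 'X_v - 'X_u1 * 'X_v1 + 'X_u2 * 'X_v2),
      (spread u1 + spread v1 < spread u + spread v)%N &
      (spread u2 + spread v2 < spread u + spread v)%N].
Proof.
case Eu: (nth_pair u) => [a d]; case Ev: (nth_pair v) => [b c].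
have := nth_pair_lt u; have := nth_pair_lt v; rewrite /nested Eu Ev /=.
move=> bc ad /andP[ab cd].
have [u1 E1] := nth_pair_surj (ltn_trans ab bc).
have [v1 F1] := nth_pair_surj (ltn_trans bc cd).
have [u2 E2] := nth_pair_surj ab.
have [v2 F2] := nth_pair_surj cd.
exists u1, v1, u2, v2; split; last 2 first.
- rewrite /spread Eu Ev E1 F1 /=; nia.
- rewrite /spread Eu Ev E2 F2 /=; nia.
apply: three_term_low_rank => [|A x].
  rewrite !inE -!(inj_eq (@nth_pair_inj n)) Eu E1 F1 E2 F2 !xpair_eqE.
  rewrite -!val_eqE /=; lia.
rewrite /x !pluckerE Eu Ev E1 F1 E2 F2 /=; ring.
Qed.

Definition straightens d f : Prop :=
  exists p, [/\ J (f - p), p \is d.-homog & {in msupp p, forall m, standard m}].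

Lemma straightens_lin d c f g :
  straightens d f -> straightens d g -> straightens d (c *: f + g).
Proof.
move=> [p [Jp hp sp]] [q [Jq hq sq]]; exists (c *: p + q); split.
- have -> : c *: f + g - (c *: p + q) = c%:MP * (f - p) + (g - q).
    by rewrite mul_mpolyC scalerBr; ring.
  exact/ideal_genD/Jq/ideal_genM.
- by rewrite rpredD ?rpredZ.
move=> m; rewrite mcoeff_msupp mcoeffD mcoeffZ => nz.
have [mp|mp] := boolP (m \in msupp p); first exact: sp.
apply: sq; rewrite mcoeff_msupp; move: nz.
by rewrite (memN_msupp_eq0 mp) mulr0 add0r.
Qed.

Lemma straightens0 d : straightens d 0.
Proof.
exists 0; rewrite subr0 dhomog0; split=> //; first exact: ideal_gen0.
by move=> m; rewrite msupp0.
Qed.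

Lemma straightensD_ideal d f g : J g -> straightens d f -> straightens d (f + g).
Proof.
move=> Jg [p [Jp hp sp]]; exists p; split=> //.
by rewrite addrAC; apply: ideal_genD.
Qed.

Lemma total_spreadD m m' :
  total_spread (m + m')%MM = (total_spread m + total_spread m')%N.
Proof.
rewrite /total_spread -big_split; apply: eq_bigr => i _.
by rewrite mnmDE mulnDl.
Qed.

Lemma total_spread1 u : total_spread U_(u)%MM = spread u.
Proof.
rewrite /total_spread (bigD1 u) //= mnm1E eqxx mul1n big1 ?addn0 // => v vu.
by rewrite mnm1E eq_sym (negPf vu).
Qed.

(* A nested product is traded for two products of smaller total spread. *)
Lemma straightensX m : straightens (mdeg m) 'X_[m].
Proof.
have [k] := ubnP (total_spread m); elim: k m => // k IHk m /ltnSE le_k.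
have [sm|] := boolP (standard m).
  exists 'X_[m]; rewrite subrr dhomogX eqxx; split=> //; first exact: ideal_gen0.
  by move=> m'; rewrite msuppX inE => /eqP->.
rewrite negb_forall => /existsP[u]; rewrite negb_forall => /existsP[v].
rewrite negb_imply negbK => /andP[/andP[mu mv] uv].
have [u1 [v1 [u2 [v2 [Jq sp1 sp2]]]]] := nested_relation uv.
(* Nesting is strict, so u and v differ and the product of the two variables divides the
   monomial. *)
have [m0 Em] : exists m0, m = (m0 + (U_(u) + U_(v)))%MM.
  exists (m - (U_(u) + U_(v)))%MM; rewrite submK //.
  apply/mnm_lepP => w; rewrite mnmDE !mnm1E.
  have [uw|_] := eqVneq u w; have [vw|_] := eqVneq v w; rewrite ?addn0 //.
  - by move: uv; rewrite uw vw /nested ltnn.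
  - by rewrite -uw.
  - by rewrite -vw.
rewrite {}Em in le_k *.
have IH w w' : (spread w + spread w' < spread u + spread v)%N ->
    straightens (mdeg (m0 + (U_(u) + U_(v)))%MM) ('X_[m0] * ('X_w * 'X_w')).
  move=> lt_w; rewrite -!mpolyXD.
  have -> : mdeg (m0 + (U_(u) + U_(v)))%MM = mdeg (m0 + (U_(w) + U_(w')))%MM.
    by rewrite !mdegD !mdeg1.
  apply: IHk; apply: leq_trans le_k.
  by rewrite !total_spreadD !total_spread1 ltn_add2l.
have -> : 'X_[m0 + (U_(u) + U_(v))] =
    -1 *: ('X_[m0] * ('X_u2 * 'X_v2)) + 'X_[m0] * ('X_u1 * 'X_v1) +
    'X_[m0] * ('X_u * 'X_v - 'X_u1 * 'X_v1 + 'X_u2 * 'X_v2) :> {mpoly K[r]}.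
  by rewrite scaleN1r !mpolyXD; ring.
apply: straightensD_ideal; first exact/ideal_genM/ideal_gen_base.
exact/straightens_lin/IH/sp1/IH.
Qed.

Lemma homog_straightens d f : f \is d.-homog -> straightens d f.
Proof.
move=> hf; rewrite (mpolyE f) big_seq.
elim/big_rec: _ => [|m g mf IH]; first exact: straightens0.
apply: straightens_lin IH; rewrite -(dhomog_mf hf mf); exact: straightensX.
Qed.

End Straightening.

(** * Uniqueness of base-B digits *)

Lemma digits_lt (B N : nat) (f : 'I_N -> nat) :
  (forall i, f i < B)%N -> (\sum_i f i * B ^ i < B ^ N)%N.
Proof.
elim: N f => [|N IHN] f fB; first by rewrite big_ord0.
rewrite big_ord_recr /= expnS.
have := IHN (fun i => f (widen_ord (leqnSn N) i)) (fun i => fB _).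
have := fB ord_max; set S := (\sum_(i < N) _)%N; nia.
Qed.

(** Division by B^N isolates the top digit, since the lower digits sum to less than B^N; induction
    handles the rest. *)
Lemma digits_inj (B N : nat) (f g : 'I_N -> nat) :
  (forall i, f i < B)%N -> (forall i, g i < B)%N ->
  (\sum_i f i * B ^ i = \sum_i g i * B ^ i)%N -> f =1 g.
Proof.
elim: N f g => [|N IHN] f g fB gB; first by move=> _ [].
rewrite !big_ord_recr /=.
pose w := widen_ord (leqnSn N).
have wf := digits_lt (fun i => fB (w i)).
have wg := digits_lt (fun i => gB (w i)).
move=> E.
have E1 : f ord_max = g ord_max.
  have B0 : (0 < B ^ N)%N by lia.
  have := congr1 (divn^~ (B ^ N)%N) E.
  by rewrite /= ![(_ + _ * _)%N]addnC !divnMDl // !divn_small // !addn0.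
have E2 := IHN _ _ (fun i => fB (w i)) (fun i => gB (w i)) _.
move=> i; have [j ->|->] := unliftP ord_max i; last by [].
have -> : lift ord_max j = w j.
  by apply: val_inj; rewrite /= /bump leqNgt ltn_ord.
by apply: E2; move: E; rewrite E1 => /addIn.
Qed.

(** * Standard monomials are determined by their margins and leading degree *)

Section Standard.

Variable n : nat.
Local Notation r := 'C(n.+1, 2).
Implicit Types (u v : 'I_r) (m : 'X_{1..r}) (i j : 'I_n.+1).

(** The two margins are the contents of the first and the second row of the tableau. *)
Definition row_margin m i : nat := \sum_(u | (nth_pair u).1 == i) m u.
Definition col_margin m j : nat := \sum_(u | (nth_pair u).2 == j) m u.

Lemma sum_eq_exists_lt (P : pred 'I_r) (F F' : 'I_r -> nat) u :
  P u -> (F' u < F u)%N -> (\sum_(v | P v) F v = \sum_(v | P v) F' v)%N ->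
  exists2 v, P v & (F v < F' v)%N.
Proof.
move=> Pu lt_u E; apply/exists_inP; apply: contra_eqT E => /exists_inPn le.
rewrite neq_ltn; apply/orP; right; rewrite (bigD1 u) //= [ltnRHS](bigD1 u) //=.
rewrite -addSn leq_add // leq_sum // => v /andP[Pv _].
by have := le v Pv; rewrite -leqNgt.
Qed.

(* At the lexicographically first pair (i, j) where m and m' differ, with
   m' (i, j) < m (i, j), the margins force m' to contain some (i, j') and (i', j)
   with j < j' and i < i', which are nested. *)
Lemma standard_margins_inj m m' : standard m -> standard m' ->
  row_margin m =1 row_margin m' -> col_margin m =1 col_margin m' -> m = m'.
Proof.
move=> sm sm' Er Ec; apply/eqP; apply/negP => /negP ne.
have [u0 u0P] : exists u, m u != m' u.
  apply/existsP; apply: contraR ne => /existsPn eq_m; apply/eqP/mnmP => u.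
  by apply/eqP; move: (eq_m u); rewrite negbK.
(* The second index is at most n, so comparing keys is comparing pairs lexicographically. *)
pose key u := ((nth_pair u).1 * n.+1 + (nth_pair u).2)%N.
case: (arg_minnP (P := fun u => m u != m' u) key u0P) => u uP umin.
wlog lt_u : m m' sm sm' Er Ec {ne u0P} uP umin / (m' u < m u)%N.
  move=> W; have [lt_u|lt_u|eq_u] := ltngtP (m u) (m' u).
  - have umin' v : m' v != m v -> (key u <= key v)%N by rewrite eq_sym; apply: umin.
    by apply: (W m' m sm' sm (fsym Er) (fsym Ec)); rewrite // eq_sym.
  - exact: (W m m').
  - by rewrite eq_u eqxx in uP.
have [v /eqP v1 lt_v] := sum_eq_exists_lt (eqxx (nth_pair u).1) lt_u (Er _).
have [w /eqP w2 lt_w] := sum_eq_exists_lt (eqxx (nth_pair u).2) lt_u (Ec _).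
have neq x : (m x < m' x)%N -> nth_pair x != nth_pair u.
  move=> lt_x; apply/eqP => /nth_pair_inj E.
  by move: lt_x; rewrite E ltnNge ltnW.
have v2 : ((nth_pair u).2 < (nth_pair v).2)%N.
  have := umin v; have := neq v lt_v; rewrite neq_ltn lt_v => + /(_ isT).
  rewrite /key v1; move: v1; case: (nth_pair v) (nth_pair u) => [a b] [a' b'] /= ->.
  rewrite xpair_eqE eqxx /= -val_eqE /=; lia.
have w1 : ((nth_pair u).1 < (nth_pair w).1)%N.
  have := umin w; have := neq w lt_w; rewrite neq_ltn lt_w => + /(_ isT).
  rewrite /key w2; move: w2; case: (nth_pair w) (nth_pair u) => [a b] [a' b'] /= ->.
  rewrite xpair_eqE eqxx andbT -val_eqE /=; nia.
move/forallP/(_ v)/forallP/(_ w): sm'; rewrite /nested v1 w2 w1 v2.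
by rewrite (leq_ltn_trans (leq0n _) lt_v) (leq_ltn_trans (leq0n _) lt_w).
Qed.

(* Weights of x_i and y_j in the leading term x_i y_j of a Plücker coordinate. *)
Definition xwt (B : nat) i : nat := B ^ (n.+1 + rev_ord i).
Definition ywt (B : nat) j : nat := B ^ j.

Definition lead_deg (B : nat) m : nat :=
  \sum_u m u * (xwt B (nth_pair u).1 + ywt B (nth_pair u).2).

Lemma lead_degE B m :
  lead_deg B m = ((\sum_i row_margin m (rev_ord i) * B ^ i) * B ^ n.+1 +
                  \sum_j col_margin m j * B ^ j)%N.
Proof.
rewrite (reindex_inj rev_ord_inj) /= big_distrl /lead_deg.
under eq_bigr do rewrite mulnDr.
rewrite big_split /=; congr (_ + _)%N.
  rewrite (partition_big (fun u => (nth_pair u).1) xpredT) //=.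
  apply: eq_bigr => i _; rewrite rev_ordK /row_margin !big_distrl /=.
  by apply: eq_bigr => u /eqP->; rewrite /xwt expnD -mulnA [(B ^ _ * _)%N]mulnC.
rewrite (partition_big (fun u => (nth_pair u).2) xpredT) //=.
apply: eq_bigr => j _; rewrite /col_margin !big_distrl /=.
by apply: eq_bigr => u /eqP->.
Qed.

Lemma margins_le m i : (row_margin m i <= mdeg m)%N /\ (col_margin m i <= mdeg m)%N.
Proof.
rewrite mdegE; split.
  by rewrite [leqRHS](bigID (fun u => (nth_pair u).1 == i)) leq_addr.
by rewrite [leqRHS](bigID (fun u => (nth_pair u).2 == i)) leq_addr.
Qed.

(** Margins are bounded by the degree, so they are genuine base-B digits. The remainder modulo
    B^(n+1) holds the column margins and the quotient holds the row margins in reverse order. *)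
Lemma lead_deg_inj B m m' : (mdeg m < B)%N -> (mdeg m' < B)%N ->
  standard m -> standard m' -> lead_deg B m = lead_deg B m' -> m = m'.
Proof.
move=> mB m'B sm sm'; rewrite !lead_degE => E.
have rB m0 : (mdeg m0 < B)%N -> forall i, (row_margin m0 i < B)%N.
  by move=> dm i; have [le_r _] := margins_le m0 i; lia.
have cB m0 : (mdeg m0 < B)%N -> forall i, (col_margin m0 i < B)%N.
  by move=> dm i; have [_ le_c] := margins_le m0 i; lia.
have S m0 : (mdeg m0 < B)%N -> (\sum_j col_margin m0 j * B ^ j < B ^ n.+1)%N.
  by move=> /cB; apply: digits_lt.
have Ec := congr1 (modn^~ (B ^ n.+1)%N) E.
rewrite /= !modnMDl !modn_small ?S // in Ec.
have Er : (\sum_i row_margin m (rev_ord i) * B ^ i =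
           \sum_i row_margin m' (rev_ord i) * B ^ i)%N.
  have B0 : (0 < B ^ n.+1)%N by rewrite expn_gt0; lia.
  by apply/eqP; rewrite -(eqn_pmul2r B0); move/eqP: E; rewrite Ec eqn_add2r.
apply: standard_margins_inj => // [i|j].
  rewrite -[i]rev_ordK; move: (rev_ord i).
  by apply: (digits_inj (B := B)) Er => j; apply: rB.
by move: j; apply: (digits_inj (B := B)) Ec; apply: cB.
Qed.

End Standard.

(** The summand of largest size has a leading coefficient that nothing else can cancel. *)
Lemma monic_distinct_size_sum_neq0 (R : idomainType) (T : eqType) (s : seq T)
    (c : T -> R) (F : T -> {poly R}) :
  s != [::] -> uniq s -> {in s, forall t, c t != 0} ->
  {in s, forall t, F t \is monic} -> {in s &, injective (fun t => size (F t))} ->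
  \sum_(t <- s) c t *: F t != 0.
Proof.
move=> s0 us c0 monF injF.
have [t ts tmax] : exists2 t, t \in s & {in s, forall t', size (F t') <= size (F t)}%N.
  elim: s s0 {us c0 monF injF} => // a [_ _|b s IH _].
    by exists a => [|t']; rewrite inE ?eqxx // => /eqP->.
  have [t ts tmax] := IH isT.
  case: (leqP (size (F a)) (size (F t))) => le_a.
    by exists t => [|t']; rewrite inE ?ts ?orbT // => /predU1P[->|/tmax].
  exists a => [|t']; rewrite inE ?eqxx // => /predU1P[->//|/tmax].
  by move/leq_trans; apply; apply: ltnW.
apply/eqP => /(congr1 (fun p : {poly R} => p`_(size (F t)).-1)) /eqP.
rewrite coef0 coef_sum (bigD1_seq t) //= big1_seq ?addr0 => [|t' /andP[tt' t's]].
  by rewrite coefZ -lead_coefE (monicP (monF t ts)) mulr1 (negPf (c0 t ts)).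
rewrite coefZ nth_default ?mulr0 //.
have : size (F t') != size (F t) by apply: contra_neq tt' => /injF->.
have := tmax t' t's; rewrite leq_eqVlt => /orP[/eqP->|]; first by rewrite eqxx.
by case: (size (F t)).
Qed.

(** * Linear independence of standard monomials along a curve *)

Section Independence.

Variables (K : closedFieldType) (n : nat).
Local Notation r := 'C(n.+1, 2).

(* The Plücker coordinates of the line spanned by x_i = t^(xwt i), y_j = t^(ywt j). *)
Definition curve_coord (B : nat) (u : 'I_r) : {poly K} :=
  'X^(xwt B (nth_pair u).1 + ywt B (nth_pair u).2) -
  'X^(xwt B (nth_pair u).2 + ywt B (nth_pair u).1).

(** For i < j the weight of x_i exceeds that of x_j and the weight of y_j exceeds that of y_i, so
    x_i y_j dominates x_j y_i. *)
Lemma curve_coord_monic B u : (1 < B)%N ->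
  curve_coord B u \is monic /\
  size (curve_coord B u) = (xwt B (nth_pair u).1 + ywt B (nth_pair u).2).+1.
Proof.
move=> B1; rewrite /curve_coord; set e := (_ + _)%N; set e' := (_ + _)%N.
have lt_e : (size (- 'X^e' : {poly K}) < size ('X^e : {poly K}))%N.
  rewrite size_polyN !size_polyXn ltnS /e /e' /xwt /ywt.
  have := nth_pair_lt u; case: (nth_pair u) => i j /= ij.
  have jn := ltn_ord j.
  by rewrite -addSn leq_add ?ltn_exp2l ?leq_exp2l ?(ltnW ij) //=; lia.
by rewrite monicE lead_coefDl // lead_coefXn size_polyDl // size_polyXn.
Qed.

Lemma curve_monomial_monic B (m : 'X_{1..r}) : (1 < B)%N ->
  \prod_u curve_coord B u ^+ m u \is monic /\
  size (\prod_u curve_coord B u ^+ m u) = (lead_deg B m).+1.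
Proof.
move=> B1; have mon u := (curve_coord_monic u B1).1.
split; first by apply: monic_prod => u _; rewrite monic_exp.
(* Nonvanishing is carried along because sizes add, up to the shift by one, only for nonzero
   factors. *)
have [] // : \prod_u curve_coord B u ^+ m u != 0 /\
  size (\prod_u curve_coord B u ^+ m u) = (lead_deg B m).+1.
rewrite /lead_deg; apply: (big_ind2 (fun (p : {poly K}) (d : nat) => p != 0 /\ size p = d.+1)).
- by rewrite oner_eq0 size_poly1.
- move=> p d q e [p0 sp] [q0 sq]; rewrite mulf_neq0 // size_mul // sp sq.
  by rewrite addSn addnS.
move=> u _; have [mu su] := curve_coord_monic u B1.
rewrite expf_neq0 ?monic_neq0 // -(prednK (_ : 0 < size _)%N); last first.
  by rewrite size_poly_gt0 expf_neq0 ?monic_neq0.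
by rewrite size_exp su mulnC.
Qed.

Lemma standard_independent d (p : {mpoly K[r]}) :
  p \is d.-homog -> {in msupp p, forall m, standard m} ->
  (forall A : 'M[K]_(2, n.+1), p.@[plucker A ord0] = 0) -> p = 0.
Proof.
move=> hp sp p0; apply/eqP; rewrite -msupp_eq0; apply/negP => /negP supp0.
(* This exceeds d, as the digits require, and exceeds 1 even when d = 0. *)
pose B := d.+2.
pose P := \sum_(m <- msupp p) p@_m *: \prod_u curve_coord B u ^+ m u.
have dB m : m \in msupp p -> (mdeg m < B)%N.
  by move=> /(dhomog_mf hp) => E; rewrite /B -E.
have P0 : P != 0.
  apply: monic_distinct_size_sum_neq0 => // [m|m _|m m' mp m'p].
  - by rewrite mcoeff_msupp.
  - by have [] := @curve_monomial_monic B m isT.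
  have [_ ->] := @curve_monomial_monic B m isT.
  have [_ ->] := @curve_monomial_monic B m' isT.
  by move=> [] /lead_deg_inj; apply; rewrite ?dB ?sp.
(* An algebraically closed field is infinite, so the nonzero [P] has a nonroot t; but P(t) is the
   value of p at the curve point of parameter t. *)
have [t] := elimT (closed_nonrootP P) P0.
apply/negP; rewrite negbK; apply/rootP.
pose A : 'M[K]_(2, n.+1) :=
  \matrix_(k, i) if k == ord0 then t ^+ xwt B i else t ^+ ywt B i.
rewrite -[RHS](p0 A) mevalE horner_sum; apply: eq_bigr => m _.
rewrite hornerZ horner_prod; congr (_ * _); apply: eq_bigr => u _.
rewrite horner_exp /curve_coord hornerD hornerN !hornerXn pluckerE !mxE /=.
by rewrite !exprD [t ^+ xwt B (nth_pair u).2 * _]mulrC.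
Qed.

End Independence.

(** * Generation of the ideal by quadrics of rank 6, and the rank index *)

(** The standard remainder p of f vanishes at all Plücker vectors, because f and f - p do;
    independence then gives p = 0. *)
Lemma homog_vanishing_generated (K : closedFieldType) (n d : nat)
    (f : {mpoly K['C(n.+1, 2)]}) :
  (0 < n)%N -> f \is d.-homog ->
  (forall x, @grassmannian_lines K n x -> f.@[x ord0] = 0) ->
  ideal_gen (@low_rank_quadric K n) f.
Proof.
move=> n_gt0 hf f0; have [p [Jp hp sp]] := homog_straightens n_gt0 hf.
have p0 : p = 0.
  apply: standard_independent hp sp _ => A.
  have : (f - p).@[plucker A ord0] = 0.
    apply: ideal_gen_eval0 Jp => q [_ _]; exact: hom_ideal_eval_plucker.
  by rewrite mevalB (homog_eval_plucker n_gt0 A hf f0) sub0r => /eqP; rewrite oppr_eq0 => /eqP.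
by rewrite p0 subr0 in Jp.
Qed.

(** For n >= 3 the indices 0 < 1 < 2 < 3 provide the nested pairs (0, 3) and (1, 2). *)
Lemma low_rank_quadric_exists (K : fieldType) (n : nat) :
  (3 <= n)%N -> exists q, @low_rank_quadric K n q.
Proof.
move=> hn; have n_gt0 : (0 < n)%N by lia.
have [u Eu] : exists u, nth_pair u = (inord 0, inord 3) :> 'I_n.+1 * 'I_n.+1.
  by apply: nth_pair_surj; rewrite !inordK //; lia.
have [v Ev] : exists v, nth_pair v = (inord 1, inord 2) :> 'I_n.+1 * 'I_n.+1.
  by apply: nth_pair_surj; rewrite !inordK //; lia.
have uv : nested u v by rewrite /nested Eu Ev /= !inordK //; lia.
have [u1 [v1 [u2 [v2 [Lq _ _]]]]] := nested_relation K n_gt0 uv.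
by exists ('X_u * 'X_v - 'X_u1 * 'X_v1 + 'X_u2 * 'X_v2).
Qed.

Theorem theorem5p1 (K : closedFieldType) (n : nat) (hn : (3 <= n)%N) :
  is_rank_index (@grassmannian_lines K n) 6 /\
  (forall q : {mpoly K['C(n.+1, 2)]},
     hom_ideal (@grassmannian_lines K n) q -> quadratic_polynomial q ->
     ~ (quad_rank q <= 5)%N).
Proof.
have n_gt0 : (0 < n)%N by lia.
have rank_ge6 := hom_ideal_rank_ge6 n_gt0.
split; last by move=> q Iq Qq; apply/negP; rewrite -ltnNge; apply: rank_ge6.
split.
  exists (@low_rank_quadric K n); split=> [q [Qq rq _] //|p]; split.
    move=> [s [sX ->]]; apply: ideal_gen_sum => t /sX [[d ht] t0].
    exact/ideal_genM/(homog_vanishing_generated n_gt0 ht t0).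
  move=> [s [sG ->]]; apply: ideal_gen_sum => t /sG [_ _ It].
  exact: ideal_genM.
move=> k [G [Grank IG]].
(* The ideal contains a nonzero form, so a generating set cannot be empty; the rank of any generator
   lies between 6 and k. *)
have [q Gq] : exists q, G q.
  have [q [[q0 _] _ Iq]] := low_rank_quadric_exists K hn.
  have [[|t s] [sG qE]] := (IG q).1 Iq.
    by rewrite qE big_nil eqxx in q0.
  by exists t.2; apply: sG; rewrite inE eqxx.
have [Qq rq] := Grank q Gq.
by apply: leq_trans rq; apply: rank_ge6 => //; apply/IG/ideal_gen_base.
Qed.
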